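(* Let $n,a,b\ge 0$ and $m\ge 1$ be integers and set $N=n+a$. Let $\lambda$ be the strict partition with $N$ parts given by $\lambda=(n+a+b,\,n+a+b-1,\,\dots,\,b+1)+(m-1)\delta_{N}$, i.e. $\lambda_k=n+a+b+1-k+(m-1)(N-k)$ for $1\le k\le N$, and let $\pi=\lambda^\ast/(\delta_{a+1})^\ast$. Then the number $g^\pi$ of standard Young tableaux of shape $\pi$ is \[ g^\pi = \frac{|\pi|!}{2^a} \cdot \frac{\Phi(n+2a)\Phi(a)}{\Phi(2a)\Phi(n+a)} \cdot \frac{\gimel(2a)\gimel(n)}{\gimel(n+2a)} \prod_{(i,j)\in \lambda^\ast\setminus D}\frac{1}{h_{\lambda^*} (i,j)}, \] where $D$ is the set of cells $(i,n+j)$ with $1\le i\le j\le a$.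
   Context: $\Phi(k)=\prod_{i=1}^{k-1} i!$ and $\gimel(k)=\prod_{i=1}^{\lfloor k/2\rfloor}(k-2i)!$ (empty products equal $1$). $\delta_k=(k-1,k-2,\dots,1,0)$. For a strict partition $\nu$ (i.e. $\nu_1>\nu_2>\dots>\nu_{\ell}>0$), its shifted Young diagram is $\nu^\ast=\{(i,j): 1\le i\le \ell,\ i\le j\le \nu_i+i-1\}$; for strict $\kappa,\nu$ with $\kappa^\ast\subseteq\nu^\ast$, the shifted skew shape $\nu^\ast/\kappa^\ast$ is the set difference, and $|\pi|$ denotes the number of cells. A standard Young tableau of shape $\pi$ is a filling of its cells with $1,\dots,|\pi|$, each once, increasing along rows and down columns. Shifted hook lengths: if $\lambda$ is strict with $\ell(\lambda)=N$, write $\lambda=\delta_{N+1}+\mu$ with $\mu=(\mu_1,\dots,\mu_N)$ a partition; for $(i,j)\in\lambda^\ast$, $h_{\lambda^\ast}(i,j)=N+1+\mu_i$ if $i=j$; $h_{\lambda^\ast}(i,j)=\mu_i+\mu_j+2(N+1)-i-j$ if $i<j\le N$; and $h_{\lambda^\ast}(i,j)=h_\mu(i,j-N)$ if $j>N$, where $h_\mu(i,k)=\mu_i+\mu'_k-i-k+1$ is the ordinary hook length in the Young diagram of $\mu$ ($\mu'$ the conjugate partition).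
   Formalization: The diagonal hook is taken as N+1-i+μ_i (= λ_i) instead of the printed N+1+μ_i, with which the formula fails (e.g. λ=(1)); and the case n=0 with a≥1 is excluded, since there the right side equals g^π/2^a. *)

(* Defs.v *)
From mathcomp Require Import all_boot all_order all_algebra finmap.

Set Implicit Arguments.
Unset Strict Implicit.
Unset Printing Implicit Defensive.

Local Open Scope fset_scope.
Local Open Scope nat_scope.

Definition Phi (k : nat) : nat := \prod_(1 <= i < k) i`!.

Definition gimel (k : nat) : nat := \prod_(1 <= i < k./2.+1) (k - 2 * i)`!.

(* Partitions are sequences of parts, cells are pairs (row, column); rows,
   columns and parts are numbered from 1. *)
Definition part (nu : seq nat) (i : nat) : nat := nth 0 nu i.-1.

Definition delta (k : nat) : seq nat := [seq k - i | i <- iota 1 k].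

(* Row i consists of the columns i, ..., nu_i + i - 1; a trailing zero part, as
   in delta, contributes no cell. *)
Definition shifted_diagram (nu : seq nat) : {fset nat * nat} :=
  [fset c in [seq (i, j) | i <- iota 1 (size nu), j <- iota i (part nu i)]].

Definition shifted_skew (nu kappa : seq nat) : {fset nat * nat} :=
  shifted_diagram nu `\` shifted_diagram kappa.

(* The entry of the cell c is (t c).+1, which ranges over 1, ..., #|` p|.  An
   injective filling uses each of these #|` p| values exactly once. *)
Definition is_SYT (p : {fset nat * nat}) (t : {ffun p -> 'I_(#|` p|)}) : bool :=
  [&& injectiveb t,
      [forall c : p, forall d : p,
         ((val c).1 == (val d).1) && ((val c).2 < (val d).2) ==> (t c < t d)]
    & [forall c : p, forall d : p,
         ((val c).2 == (val d).2) && ((val c).1 < (val d).1) ==> (t c < t d)]].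

Definition num_SYT (p : {fset nat * nat}) : nat :=
  #|[set t : {ffun p -> 'I_(#|` p|)} | is_SYT t]|.

Definition conj_part (mu : seq nat) (k : nat) : nat := count (leq k) mu.

Definition hook (mu : seq nat) (i k : nat) : nat :=
  part mu i + conj_part mu k + 1 - (i + k).

(* The partition mu with la = delta_(N+1) + mu, for la strict with exactly N
   (positive) parts; then la_i >= N + 1 - i, so the subtraction is exact. *)
Definition unshift (la : seq nat) : seq nat :=
  [seq part la i - part (delta (size la).+1) i | i <- iota 1 (size la)].

(* On the cells of the shifted diagram of a strict la with positive parts all
   subtractions are exact.  The diagonal value N + 1 - i + mu_i is la_i; it sits
   at (i, i), and la_i + la_j at (i, j) for i < j <= N, which permutes within
   row i the usual placement of the shifted hook lengths. *)
Definition shifted_hook (la : seq nat) (c : nat * nat) : nat :=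
  let: (i, j) := c in
  let N := size la in
  let mu := unshift la in
  if i == j then N + 1 - i + part mu i
  else if j <= N then part mu i + part mu j + 2 * (N + 1) - i - j
  else hook mu i (j - N).

Definition lam (n a b m : nat) : seq nat :=
  [seq (n + a + b + 1 - k) + (m - 1) * (n + a - k) | k <- iota 1 (n + a)].

(* D meets the main diagonal only if n = 0.  In that case lam n a b m / delta_(a+1)
   is the straight shape mu, and for a > 0 the product formula with the factor
   1 / 2 ^ a fails (it gives 1 / 2 ^ a times the number of tableaux). *)
Definition Dcells (n a : nat) : {fset nat * nat} :=
  [fset c in [seq (i, n + j) | i <- iota 1 a, j <- iota i (a + 1 - i)]].

(* Main.v *)
(** Read the rows from the bottom: [x_j] is the length of row [N - j], where
    [N = n + a]. Let [D] be the alternant in the [x_j] with exponents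
    [0, ..., n-1, n+1, n+3, ..., n+2a-1], let [W = D / \prod_(i < j) (x_i + x_j)],
    and let [T_k] be the substitution of [x_k - 1] for [x_k]. For every strict
    partition the number of tableaux of [lambda^* / delta_(a+1)^*] is
    [|pi|! * W / \prod_j x_j!]. Indeed, removing the largest entry reduces this to
    the eigenvalue equation [\sum_k x_k T_k W = |pi| W]. The latter is proved by
    induction on [a] from
    [W_(a+1) x = \sum_j (+/-) x_j (x_j - 1) ... (x_j - a) W_a (x without x_j)];
    for [a = 0] it is an instance of Lagrange interpolation.

    If the [x_j] form an arithmetic progression, then taking centered differences
    [n] times turns [D] into the alternant with the odd exponents
    [1, 3, ..., 2a-1], which factors into sums [x_(n+i) + x_j]: these are the hook
    lengths in the cells of [Dcells n a], and so these cancel from the product of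
    all hook lengths. *)

Require Import Defs.
From mathcomp Require Import all_boot all_order all_algebra finmap.
From mathcomp Require Import ring zify.

Set Implicit Arguments.
Unset Strict Implicit.
Unset Printing Implicit Defensive.

Import GRing.Theory Num.Theory.
Local Open Scope fset_scope.
Local Open Scope ring_scope.

Definition omit (T : Type) (k : nat) (x : nat -> T) (i : nat) : T := x (bump k i).

Lemma big_omit (R : Type) (idx : R) (op : Monoid.com_law idx) N k (f : nat -> R) :
    (k <= N)%N ->
  \big[op/idx]_(j < N.+1) f j = op (f k) (\big[op/idx]_(j < N) omit k f j).
Proof. by rewrite -ltnS => kN; rewrite (bigD1_ord (Ordinal kN)). Qed.

Lemma big_iota_rev (R : Type) (idx : R) (op : Monoid.com_law idx) m d (f : nat -> R) :
  \big[op/idx]_(i <- iota m d) f i = \big[op/idx]_(k < d) f (m + d - k.+1)%N.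
Proof.
have -> : iota m d = index_iota m (m + d) by rewrite /index_iota addKn.
rewrite -{1}[m]add0n big_addn addKn big_nat_rev big_mkord.
by apply: eq_bigr => k _; congr f; have := ltn_ord k; lia.
Qed.

Lemma prod_fsetD (T : choiceType) (R : comPzRingType) (A B : {fset T}) (f : T -> R) :
  B `<=` A -> \prod_(c <- A) f c = \prod_(c <- A `\` B) f c * \prod_(c <- B) f c.
Proof.
move=> /fsubsetP BA; rewrite (big_fsetID _ (mem B)) mulrC; congr (_ * _).
  by apply: eq_fbigl => c; rewrite !inE /= andb_idl //; apply: BA.
by apply: eq_fbigl => c; rewrite !inE /= andbC.
Qed.

Lemma bump_lt k i N : (k <= N)%N -> (i < N)%N -> (bump k i < N.+1)%N.
Proof. by rewrite /bump; case: leqP; lia. Qed.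

Section PairProducts.

Variable R : comPzRingType.
Implicit Types (g h : nat -> nat -> R) (x y : nat -> R) (N k : nat).

Definition pairprod N g : R := \prod_(i < N) \prod_(j < i) g i j.

Definition pairdiff N x : R := pairprod N (fun i j => x i - x j).

Definition pairsum N x : R := pairprod N (fun i j => x i + x j).

Lemma eq_pairprod N g h :
  (forall i j, (j < i < N)%N -> g i j = h i j) -> pairprod N g = pairprod N h.
Proof.
by move=> gh; apply: eq_bigr => i _; apply: eq_bigr => j _; apply: gh; rewrite !ltn_ord.
Qed.

Lemma eq_pairprod_op (op : R -> R -> R) N x y :
    (forall i, (i < N)%N -> x i = y i) ->
  pairprod N (fun i j => op (x i) (x j)) = pairprod N (fun i j => op (y i) (y j)).
Proof.
move=> xy; apply: eq_pairprod => i j /andP[ji iN].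
by rewrite !xy // (ltn_trans ji).
Qed.

Lemma eq_pairdiff N x y :
  (forall i, (i < N)%N -> x i = y i) -> pairdiff N x = pairdiff N y.
Proof. exact: (eq_pairprod_op (fun u v => u - v)). Qed.

Lemma eq_pairsum N x y :
  (forall i, (i < N)%N -> x i = y i) -> pairsum N x = pairsum N y.
Proof. exact: (eq_pairprod_op +%R). Qed.

Lemma pairprodS N g : pairprod N.+1 g = pairprod N g * \prod_(j < N) g N j.
Proof. exact: big_ord_recr. Qed.

Lemma pairprodM N g h :
  pairprod N (fun i j => g i j * h i j) = pairprod N g * pairprod N h.
Proof.
by rewrite /pairprod -big_split; apply: eq_bigr => i _; rewrite big_split.
Qed.

Lemma pairprod_omit (c : R) N k g :
    (k <= N)%N -> (forall i j, g i j = c * g j i) ->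
  pairprod N.+1 g = c ^+ (N - k) * \prod_(i < N) omit k (g k) i
                    * pairprod N (fun i j => g (bump k i) (bump k j)).
Proof.
move=> kN gc; elim: N kN => [|N IHN] kN.
  move: kN; rewrite leqn0 => /eqP->.
  by rewrite /pairprod big_ord1 !big_ord0 !mulr1.
rewrite pairprodS; case: (ltnP k N.+1) => kN1; last first.
  have -> : k = N.+1 by apply/eqP; rewrite eqn_leq kN.
  have bumpE i : (i < N.+1)%N -> bump N.+1 i = i by rewrite /bump; case: leqP; lia.
  rewrite subnn expr0 mul1r mulrC /omit; congr (_ * _).
    by apply: eq_bigr => i _; rewrite bumpE.
  by apply: eq_pairprod => i j ij; rewrite !bumpE //; lia.
rewrite IHN // subSn // (big_omit _ (k := k)) // exprS gc.
rewrite pairprodS (big_ord_recr N) /= /omit.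
have -> : bump k N = N.+1 by rewrite /bump -ltnS kN1.
ring.
Qed.

Lemma pairdiff_omit N k x : (k <= N)%N ->
  pairdiff N.+1 x =
  (-1) ^+ (N - k) * \prod_(i < N) (x k - omit k x i) * pairdiff N (omit k x).
Proof. by move=> kN; apply: pairprod_omit => // i j; ring. Qed.

Lemma pairsum_omit N k x : (k <= N)%N ->
  pairsum N.+1 x = \prod_(i < N) (x k + omit k x i) * pairsum N (omit k x).
Proof.
move=> kN; have := @pairprod_omit 1 N k (fun i j => x i + x j) kN.
by rewrite expr1n mul1r /pairsum => -> // i j; rewrite mul1r addrC.
Qed.

End PairProducts.

Lemma pairprod_neq0P (F : fieldType) N (g : nat -> nat -> F) :
  reflect (forall i j, (j < i < N)%N -> g i j != 0) (pairprod N g != 0).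
Proof.
apply: (iffP (prodf_neq0 _ _)) => [gN i j /andP[ji iN] | gN i _].
  by have /prodf_neq0/(_ (Ordinal ji) isT) := gN (Ordinal iN) isT.
by apply/prodf_neq0 => j _; apply: gN; rewrite !ltn_ord.
Qed.

Lemma coefM_add (R : nzSemiRingType) (p q : {poly R}) i j :
  (size p <= i.+1)%N -> (size q <= j.+1)%N -> (p * q)`_(i + j) = p`_i * q`_j.
Proof.
move=> sp sq; rewrite coefM (bigD1 (inord i)) //= inordK ?ltnS ?leq_addr // addKn.
rewrite big1 ?addr0 // => k.
rewrite -val_eqE /= inordK ?ltnS ?leq_addr // neq_ltn => /orP[ki|ik].
  by rewrite [q`__]nth_default ?mulr0 // (leq_trans sq) //; lia.
by rewrite nth_default ?mul0r // (leq_trans sp).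
Qed.

Section RootPolynomial.

Variable R : comNzRingType.
Implicit Types (x : nat -> R) (z : R) (N : nat).

Definition rootpoly N x : {poly R} := \prod_(i < N) ('X - (x i)%:P).

Lemma size_rootpoly N x : size (rootpoly N x) = N.+1.
Proof. by rewrite size_prod_XsubC /index_enum -enumT size_enum_ord. Qed.

Lemma coef_rootpoly_lead N x : (rootpoly N x)`_N = 1.
Proof.
have := lead_coef_prod_XsubC (index_enum 'I_N) xpredT (fun i => x i).
by rewrite lead_coefE -/(rootpoly N x) size_rootpoly.
Qed.

Lemma coef_rootpoly_sublead N x : (rootpoly N.+1 x)`_N = - \sum_(i < N.+1) x i.
Proof.
have := @coefPn_prod_XsubC R [seq x i | i : 'I_N.+1].
by rewrite size_map -cardE card_ord !big_image /= => ->.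
Qed.

Lemma horner_rootpoly N x z : (rootpoly N x).[z] = \prod_(i < N) (z - x i).
Proof. by rewrite horner_prod; apply: eq_bigr => i _; rewrite hornerXsubC. Qed.

Lemma horner_rootpoly_root N x j : (j < N)%N -> (rootpoly N x).[x j] = 0.
Proof.
by move=> jN; rewrite horner_rootpoly (bigD1 (Ordinal jN)) //= subrr mul0r.
Qed.

End RootPolynomial.

(** * Staircase alternants *)

(* The exponents 0, ..., n-1, n+1, n+3, ... in increasing order. *)
Definition stair_exp (n k : nat) : nat := k + (k.+1 - n).

Lemma stair_exp_lt n i j : (i < j)%N -> (stair_exp n i < stair_exp n j)%N.
Proof. by rewrite /stair_exp; lia. Qed.

Lemma sum_stair_exp (V : nmodType) n N (f : nat -> V) :
    (forall s, (n <= s)%N -> ~~ odd (n + s) -> f s = 0) ->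
  \sum_(s < stair_exp n N) f s = \sum_(k < N) f (stair_exp n k).
Proof.
move=> f0; elim: N => [|N IHN].
  rewrite big_ord0 /stair_exp add0n; case: n f0 => [|n] f0.
    by rewrite subn0 big_ord1 f0.
  by rewrite subSS sub0n big_ord0.
rewrite [RHS]big_ord_recr /= -IHN; case: (ltnP N.+1 n) => Nn.
  have -> : stair_exp n N.+1 = (stair_exp n N).+1 by rewrite /stair_exp; lia.
  by rewrite big_ord_recr.
have -> : stair_exp n N.+1 = (stair_exp n N).+2 by rewrite /stair_exp; lia.
by rewrite !big_ord_recr /= [f _.+1]f0 ?addr0 //; rewrite /stair_exp; lia.
Qed.

Definition altdet (R : comPzRingType) (n N : nat) (x : nat -> R) : R :=
  \det (\matrix_(i < N, j < N) x j ^+ stair_exp n i).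

Lemma eq_altdet (R : comPzRingType) n N (x y : nat -> R) :
  (forall i, (i < N)%N -> x i = y i) -> altdet n N x = altdet n N y.
Proof. by move=> xy; congr (\det _); apply/matrixP => i j; rewrite !mxE xy. Qed.

Section StairPolynomials.

Variable R : comNzRingType.
Implicit Types (p q : {poly R}) (x : nat -> R) (n N : nat).

Definition stair_poly n p : Prop :=
  forall s, (n <= s)%N -> ~~ odd (n + s) -> p`_s = 0.

Lemma horner_stair_poly n N p z : stair_poly n p -> (size p <= stair_exp n N)%N ->
  p.[z] = \sum_(k < N) p`_(stair_exp n k) * z ^+ stair_exp n k.
Proof.
move=> pS sp; rewrite (horner_coef_wide z sp).
rewrite (@sum_stair_exp _ n N (fun s => p`_s * z ^+ s)) // => s ns odd_ns.
by rewrite pS // mul0r.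
Qed.

Lemma det_stair_poly n N (p : 'I_N -> {poly R}) x :
    (forall k, stair_poly n (p k)) ->
    (forall k, (size (p k) <= (stair_exp n k).+1)%N) ->
  \det (\matrix_(i < N, j < N) (p i).[x j]) =
  (\prod_k (p k)`_(stair_exp n k)) * altdet n N x.
Proof.
move=> pS sp; pose T : 'M[R]_N := \matrix_(i, k) (p i)`_(stair_exp n k).
have -> : \matrix_(i < N, j < N) (p i).[x j] =
    T *m \matrix_(i < N, j < N) x j ^+ stair_exp n i.
  apply/matrixP => i j; rewrite !mxE (horner_stair_poly _ (N := N) (pS i)).
    by apply: eq_bigr => k _; rewrite !mxE.
  exact: leq_trans (sp i) (stair_exp_lt n (ltn_ord i)).
rewrite det_mulmx det_trig; first by congr (_ * _); apply: eq_bigr => i _; rewrite mxE.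
apply/is_trig_mxP => i j ij; rewrite mxE nth_default //.
exact: leq_trans (sp i) (stair_exp_lt n ij).
Qed.

(* Expand along the last row the determinant obtained from the alternant by
   replacing that row with the values of q. *)
Lemma altdet_expand n N q x : stair_poly n q -> (size q <= (stair_exp n N).+1)%N ->
  \sum_(j < N.+1) (-1) ^+ (N + j) * q.[x j] * altdet n N (omit j x) =
  q`_(stair_exp n N) * altdet n N.+1 x.
Proof.
move=> qS sq.
pose p (i : 'I_N.+1) := if i == ord_max then q else 'X^(stair_exp n i).
transitivity (\det (\matrix_(i < N.+1, j < N.+1) (p i).[x j])).
  rewrite (expand_det_row _ ord_max); apply: eq_bigr => j _.
  rewrite !mxE /p eqxx /cofactor mulrA [q.[_] * _]mulrC; congr (_ * _ * _).
  congr (\det _); apply/matrixP => i k; rewrite !mxE /=.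
  rewrite ifN; last by rewrite eq_sym neq_lift.
  by rewrite hornerXn /= {2}/bump leqNgt ltn_ord.
rewrite (det_stair_poly (n := n)) => [|k|k].
- rewrite big_ord_recr /= /p eqxx big1 ?mul1r // => i _.
  by rewrite -val_eqE /= ltn_eqF // coefXn eqxx.
- rewrite /p; case: eqP => // _ s ns odd_ns; rewrite coefXn.
  by case: eqP odd_ns ns => // ->; rewrite /stair_exp; lia.
- by rewrite /p; case: eqP => [->//|_]; rewrite size_polyXn.
Qed.

End StairPolynomials.

Lemma altdet_Vandermonde (R : comPzRingType) n N (x : nat -> R) :
  (N <= n)%N -> altdet n N x = pairdiff N x.
Proof.
move=> Nn; transitivity (\det (Vandermonde N (\row_(j < N) x j))).
  congr (\det _); apply/matrixP => i j; rewrite !mxE /stair_exp.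
  by congr (_ ^+ _); have := ltn_ord i; lia.
rewrite det_Vandermonde (exchange_big_dep xpredT) //=; apply: eq_bigr => i _.
rewrite (big_ord_widen N (fun j => x i - x j)) ?(ltnW (ltn_ord _)) //.
by apply: eq_bigr => j _; rewrite !mxE.
Qed.

Lemma det_scale_col (R : comPzRingType) N (x : 'I_N -> R) (A : 'M[R]_N) :
  \det (\matrix_(i, j) (x j * A i j)) = (\prod_j x j) * \det A.
Proof.
have -> : \matrix_(i, j) (x j * A i j) = A *m diag_mx (\row_j x j).
  by apply/matrixP => i j; rewrite mul_mx_diag !mxE mulrC.
by rewrite det_mulmx det_diag mulrC; congr (_ * _); apply: eq_bigr => j _; rewrite mxE.
Qed.

Lemma altdet0 (R : comPzRingType) N (x : nat -> R) :
  altdet 0 N x = (\prod_(i < N) x i) * pairdiff N x * pairsum N x.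
Proof.
rewrite -mulrA -pairprodM -(@eq_pairprod _ _ (fun i j => x i ^+ 2 - x j ^+ 2)).
  rewrite -/(pairdiff N (fun i => x i ^+ 2)) -(altdet_Vandermonde _ (leqnn N)).
  rewrite -det_scale_col; congr (\det _); apply/matrixP => i j; rewrite !mxE.
  by rewrite -exprM -exprS; congr (_ ^+ _); rewrite /stair_exp; have := ltn_ord i; lia.
by move=> i j _; ring.
Qed.

Lemma altdet_eq_col (R : comPzRingType) n N (x : nat -> R) i j :
  (i < j < N)%N -> x i = x j -> altdet n N x = 0.
Proof.
move=> /andP[ij jN] xij; rewrite /altdet -det_tr.
apply: (@determinant_alternate _ _ _ (Ordinal (ltn_trans ij jN)) (Ordinal jN)).
  by rewrite -val_eqE /= ltn_eqF.
by move=> k; rewrite !mxE /= xij.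
Qed.

Lemma altdetS_col0 (R : comPzRingType) n N (x : nat -> R) : x 0%N = 0 ->
  altdet n.+1 N.+1 x = (\prod_(i < N) x i.+1) * altdet n N (x \o succn).
Proof.
move=> x0; rewrite /altdet (expand_det_col _ 0) big_ord_recl big1 ?addr0 => [|i _].
  rewrite !mxE /= x0 /stair_exp subSS sub0n expr0 mul1r /cofactor expr0 mul1r.
  rewrite -det_scale_col; congr (\det _); apply/matrixP => i j; rewrite !mxE /=.
  by rewrite -exprS; congr (_ ^+ _); rewrite /bump; lia.
by rewrite !mxE /= x0 /stair_exp /bump add1n addSn expr0n mul0r.
Qed.

(* For n > N the alternants are Vandermonde determinants, and all polynomials of
   this size are staircase polynomials. *)
Lemma coef_interpolation (F : fieldType) N (y : nat -> F) (q : {poly F}) :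
    pairdiff N.+1 y != 0 -> (size q <= N.+1)%N ->
  \sum_(k < N.+1) q.[y k] / \prod_(i < N) (y k - omit k y i) = q`_N.
Proof.
move=> y0 sq; apply: (mulIf y0); pose n := N.+1.
have stair_expN : stair_exp n N = N by rewrite /stair_exp /n; lia.
have qS : stair_poly n q.
  by move=> s ns _; rewrite nth_default // (leq_trans sq).
have := @altdet_expand _ n N q y qS; rewrite stair_expN => /(_ sq).
rewrite altdet_Vandermonde // => <-; rewrite mulr_suml; apply: eq_bigr => k _.
have kN : (k <= N)%N by rewrite -ltnS.
move: y0; rewrite altdet_Vandermonde // (pairdiff_omit y kN) !mulf_eq0 !negb_or.
move=> /andP[/andP[_ d0] _]; rewrite -(signr_odd _ (N + k)) oddD -oddB // signr_odd.
by field.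
Qed.

Lemma sum_interpolation_ratio (F : fieldType) N (y z : nat -> F) :
    pairdiff N.+1 y != 0 ->
  \sum_(k < N.+1) (y k - z k)
    * \prod_(i < N) ((y k - omit k z i) / (y k - omit k y i)) =
  \sum_(k < N.+1) (y k - z k).
Proof.
move=> y0; pose q := rootpoly N.+1 z - rootpoly N.+1 y.
have sq : (size q <= N.+1)%N.
  apply/leq_sizeP => j; rewrite leq_eqVlt coefB => /predU1P[<-|jN].
    by rewrite !coef_rootpoly_lead subrr.
  by rewrite !nth_default ?subr0 // size_rootpoly.
transitivity q`_N; last first.
  by rewrite coefB !coef_rootpoly_sublead opprK addrC sumrB.
rewrite -(coef_interpolation y0 sq); apply: eq_bigr => k _.
rewrite hornerD hornerN horner_rootpoly_root // subr0 horner_rootpoly.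
have kN : (k <= N)%N by rewrite -ltnS.
by rewrite (big_omit _ (fun i => y k - z i) kN) prodf_div mulrA.
Qed.

Section ParityPart.

Variable R : comNzRingType.
Implicit Types (p : {poly R}) (b : bool).

Definition parity_part b p : {poly R} :=
  \poly_(i < size p) (p`_i *+ (odd i == b)).

Lemma coef_parity_part b p i : (parity_part b p)`_i = p`_i *+ (odd i == b).
Proof. by rewrite coef_poly; case: ltnP => // /leq_sizeP->; rewrite // mul0rn. Qed.

Lemma horner_parity_part b p z :
  (parity_part b p).[z] *+ 2 = p.[z] + (-1) ^+ b * p.[- z].
Proof.
rewrite horner_poly !horner_coef mulr_sumr -sumrMnl -big_split /=.
apply: eq_bigr => i _; rewrite (exprNn z) -[(-1) ^+ i]signr_odd mulr2n.
by case: b; case: (odd i); rewrite ?expr0 ?expr1 ?mulr0n ?mulr1n /=; ring.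
Qed.

End ParityPart.

Definition stair_ratio (F : fieldType) (n N : nat) (x : nat -> F) : F :=
  altdet n N x / pairsum N x.

Lemma eq_stair_ratio (F : fieldType) n N (x y : nat -> F) :
  (forall i, (i < N)%N -> x i = y i) -> stair_ratio n N x = stair_ratio n N y.
Proof. by move=> xy; rewrite /stair_ratio (eq_altdet _ xy) (eq_pairsum xy). Qed.

Lemma stair_ratio0 (F : fieldType) N (x : nat -> F) : pairsum N x != 0 ->
  stair_ratio 0 N x = (\prod_(i < N) x i) * pairdiff N x.
Proof. by move=> x0; rewrite /stair_ratio altdet0 mulfK. Qed.

Lemma stair_ratioS_col0 (F : fieldType) n N (x : nat -> F) :
    x 0%N = 0 -> (forall i, (i < N)%N -> x i.+1 != 0) ->
  stair_ratio n.+1 N.+1 x = stair_ratio n N (x \o succn).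
Proof.
move=> x0 xP; rewrite /stair_ratio altdetS_col0 // (pairsum_omit x (leq0n N)) x0.
have P0 : \prod_(i < N) x i.+1 != 0 by apply/prodf_neq0 => i _; apply: xP.
have -> : \prod_(i < N) (0 + omit 0 x i) = \prod_(i < N) x i.+1.
  by apply: eq_bigr => i _; rewrite add0r.
by rewrite invfM mulrACA mulfV // mul1r.
Qed.

(* With S = \prod_i ('X + (x i)%:P), half of S.[x j] is x j times the factors of
   pairsum that involve x j, and S.[- x j] = 0. Hence the terms are the values at
   x j of the part of f * S that consists of staircase exponents. *)
Lemma stair_ratio_expand (F : numFieldType) n a (f : {poly F}) (x : nat -> F) :
    (size f <= a.+1)%N -> pairsum (n + a).+1 x != 0 ->
  \sum_(j < (n + a).+1) (-1) ^+ (n + a + j) * (x j * f.[x j])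
     * stair_ratio n (n + a) (omit j x) =
  f`_a * stair_ratio n (n + a).+1 x.
Proof.
move=> sf; set N := (n + a)%N => x0; pose S := rootpoly N.+1 (fun i => - x i).
pose q := parity_part (odd n.+1) (f * S).
have stairN : stair_exp n N = (a + N.+1)%N by rewrite /stair_exp /N; lia.
have sfS : (size (f * S)%R <= (stair_exp n N).+1)%N.
  by rewrite (leq_trans (size_polyMleq _ _)) // size_rootpoly stairN; lia.
have qS : stair_poly n q.
  move=> s ns odd_ns; rewrite coef_parity_part.
  by have -> : odd s == odd n.+1 = false by lia.
have qN : q`_(stair_exp n N) = f`_a.
  rewrite coef_parity_part stairN.
  have -> : odd (a + N.+1) == odd n.+1 by rewrite /N; lia.
  by rewrite mulr1n coefM_add ?size_rootpoly // coef_rootpoly_lead mulr1.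
have qx j : (j <= N)%N ->
    q.[x j] = x j * f.[x j] * \prod_(i < N) (x j + omit j x i).
  move=> jN; apply: (@pmulrnI _ 2) => //; rewrite horner_parity_part !hornerM.
  rewrite [S.[- _]](horner_rootpoly_root (fun i => - x i)) // !mulr0 addr0.
  rewrite horner_rootpoly (big_omit _ (fun i => x j - - x i) jN) /omit /=.
  by under eq_bigr do rewrite opprK; ring.
have := altdet_expand x qS (leq_trans (size_poly _ _) sfS).
rewrite qN /stair_ratio mulrA => <-; rewrite mulr_suml; apply: eq_bigr => j _.
have jN : (j <= N)%N by rewrite -ltnS.
move: x0; rewrite qx // (pairsum_omit x jN) mulf_eq0 negb_or => /andP[p0 s0].
by field; rewrite p0 s0.
Qed.

(** * The eigenvalue equation *)

Definition decr (R : pzRingType) (x : nat -> R) (k i : nat) : R :=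
  x i - (i == k)%:R.

Lemma decr_same (R : pzRingType) (x : nat -> R) k : decr x k k = x k - 1.
Proof. by rewrite /decr eqxx. Qed.

Lemma decr_neq (R : pzRingType) (x : nat -> R) k i : i != k -> decr x k i = x i.
Proof. by rewrite /decr => /negbTE->; rewrite subr0. Qed.

Lemma omit_decr_same (R : pzRingType) (x : nat -> R) k i :
  omit k (decr x k) i = omit k x i.
Proof. by rewrite /omit decr_neq // eq_sym neq_bump. Qed.

Lemma omit_decr_bump (R : pzRingType) (x : nat -> R) k l i :
  omit k (decr x (bump k l)) i = decr (omit k x) l i.
Proof. by rewrite /omit /decr (inj_eq (can_inj (bumpK k))). Qed.

(* No denominator vanishes in the eigenvalue equation below. *)
Definition decr_regular (F : fieldType) (N : nat) (x : nat -> F) : Prop :=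
  [/\ pairdiff N x != 0, pairsum N x != 0
    & forall k, (k < N)%N -> pairsum N (decr x k) != 0].

Lemma decr_regular_omit (F : fieldType) N k (x : nat -> F) :
  (k <= N)%N -> decr_regular N.+1 x -> decr_regular N (omit k x).
Proof.
move=> kN [d0 s0 sD0]; split.
- by apply: contraNneq d0 => omit0; rewrite (pairdiff_omit x kN) omit0 mulr0.
- by apply: contraNneq s0 => omit0; rewrite (pairsum_omit x kN) omit0 mulr0.
move=> l lN; apply: contraNneq (sD0 _ (bump_lt kN lN)) => omit0.
rewrite (pairsum_omit _ kN) (eq_pairsum (y := decr (omit k x) l)) ?omit0 ?mulr0 //.
by move=> i _; apply: omit_decr_bump.
Qed.

Lemma stair_ratio_Vandermonde_decr (F : fieldType) N k (x : nat -> F) :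
    (k <= N)%N -> decr_regular N.+1 x ->
  stair_ratio N.+1 N.+1 (decr x k) =
  \prod_(i < N) ((x k - 1 - omit k x i) * (x k + omit k x i)
                 / ((x k - omit k x i) * (x k - 1 + omit k x i)))
  * stair_ratio N.+1 N.+1 x.
Proof.
move=> kN [d0 s0 /(_ k kN)]; move: d0 s0.
rewrite /stair_ratio !altdet_Vandermonde // !(pairdiff_omit _ kN) !(pairsum_omit _ kN).
rewrite (eq_pairdiff (fun i _ => omit_decr_same x k i)).
rewrite (eq_pairsum (fun i _ => omit_decr_same x k i)) decr_same.
have prod_omit_decr (h : F -> F) :
    \prod_(i < N) h (omit k (decr x k) i) = \prod_(i < N) h (omit k x i).
  by apply: eq_bigr => i _; rewrite omit_decr_same.
rewrite (prod_omit_decr (fun v => x k - 1 - v)) (prod_omit_decr (fun v => x k - 1 + v)).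
rewrite !mulf_eq0 !negb_or => /andP[/andP[_ d0] _] /andP[s0 so0] /andP[sD0 _].
by rewrite prodf_div !big_split /=; field; rewrite d0 s0 so0 sD0.
Qed.

Lemma stair_ratio_Vandermonde_eigen (F : numFieldType) n (x : nat -> F) :
    decr_regular n x ->
  \sum_(k < n) x k * stair_ratio n n (decr x k) =
  (\sum_(k < n) x k) * stair_ratio n n x.
Proof.
case: n => [|N] x_reg; first by rewrite !big_ord0 mul0r.
(* (x k - 1 - x i) (x k + x i) = y k - z i, (x k - x i) (x k - 1 + x i) = y k - y i *)
pose y i := x i ^+ 2 - x i; pose z i := x i ^+ 2 + x i.
have y0 : pairdiff N.+1 y != 0.
  have [d0 _ sD0] := x_reg; apply/pairprod_neq0P => i j ji.
  have [iN ji'] : (i < N.+1)%N /\ j != i by split; lia.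
  have -> : y i - y j = (x i - x j) * (decr x i i + decr x i j).
    by rewrite decr_same decr_neq // /y; ring.
  by rewrite mulf_neq0 // ?(pairprod_neq0P _ _ d0) // (pairprod_neq0P _ _ (sD0 i iN)).
have yzE k : y k - z k = -2 * x k by rewrite /y /z; ring.
have two0 : (-2 : F) != 0 by rewrite oppr_eq0 pnatr_eq0.
apply: (mulfI two0); transitivity
    ((\sum_(k < N.+1) (y k - z k)) * stair_ratio N.+1 N.+1 x); last first.
  rewrite [RHS]mulrA [X in _ = X * _]mulr_sumr.
  by under [in RHS]eq_bigr do rewrite -yzE.
rewrite -(sum_interpolation_ratio z y0) mulr_suml mulr_sumr; apply: eq_bigr => k _.
have kN : (k <= N)%N by rewrite -ltnS.
rewrite (yzE k) (stair_ratio_Vandermonde_decr kN x_reg) mulrA.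
rewrite [LHS]mulrA; congr (_ * _ * _); apply: eq_bigr => i _.
by rewrite /y /z /omit; congr (_ / _); ring.
Qed.

Definition falling (R : comPzRingType) (a : nat) (z : R) : R :=
  \prod_(i < a) (z - i%:R).

Lemma falling_recl (R : comPzRingType) a (z : R) :
  falling a.+1 z = z * \prod_(i < a) (z - i.+1%:R).
Proof. by rewrite /falling big_ord_recl subr0. Qed.

Lemma falling_pred (R : comPzRingType) a (z : R) :
  z * falling a (z - 1) = (z - a%:R) * falling a z.
Proof.
transitivity (falling a.+1 z); last by rewrite /falling big_ord_recr mulrC.
by rewrite falling_recl; congr (_ * _); apply: eq_bigr => i _; rewrite -natr1; ring.
Qed.

Lemma stair_ratio_falling (F : numFieldType) n a (x : nat -> F) :
    pairsum (n + a).+1 x != 0 ->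
  stair_ratio n (n + a).+1 x =
  \sum_(j < (n + a).+1) (-1) ^+ (n + a + j) * falling a.+1 (x j)
     * stair_ratio n (n + a) (omit j x).
Proof.
move=> x0; pose f := rootpoly a (fun i => i.+1%:R : F).
have := stair_ratio_expand (f := f) _ x0; rewrite size_rootpoly coef_rootpoly_lead.
rewrite mul1r => <- //; apply: eq_bigr => j _.
by rewrite falling_recl horner_rootpoly.
Qed.

(* Decrementing x j only affects the falling factorial, decrementing another
   variable only affects the ratio. *)
Lemma sum_decr_falling (F : fieldType) n N a j (x : nat -> F) : (j <= N)%N ->
  \sum_(k < N.+1) x k * (falling a (decr x k j) * stair_ratio n N (omit j (decr x k))) =
  falling a (x j) * ((x j - a%:R) * stair_ratio n N (omit j x)
    + \sum_(k < N) omit j x k * stair_ratio n N (decr (omit j x) k)).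
Proof.
move=> jN; rewrite (big_omit _ (fun k => x k * (falling a (decr x k j)
  * stair_ratio n N (omit j (decr x k)))) jN) /= decr_same.
rewrite (eq_stair_ratio _ (fun i _ => omit_decr_same x j i)) mulrA falling_pred.
rewrite mulrDr mulr_sumr; congr (_ + _); first by ring.
apply: eq_bigr => k _; rewrite {1 2}/omit decr_neq ?neq_bump //.
by rewrite (eq_stair_ratio _ (fun i _ => omit_decr_bump x j k i)) mulrCA.
Qed.

Lemma stair_ratio_eigen (F : numFieldType) n a (x : nat -> F) :
    decr_regular (n + a) x ->
  \sum_(k < n + a) x k * stair_ratio n (n + a) (decr x k) =
  (\sum_(k < n + a) x k - 'C(a.+1, 2)%:R) * stair_ratio n (n + a) x.
Proof.
elim: a x => [|a IHa] x.
  by rewrite addn0 subr0; exact: stair_ratio_Vandermonde_eigen.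
rewrite addnS => x_reg; have [_ s0 sD0] := x_reg.
rewrite (stair_ratio_falling s0) mulr_sumr.
under eq_bigr => k _ do rewrite (stair_ratio_falling (sD0 k (ltn_ord k))) mulr_sumr.
rewrite exchange_big; apply: eq_bigr => j _ /=.
have jN : (j <= n + a)%N by rewrite -ltnS.
transitivity ((-1) ^+ (n + a + j) * \sum_(k < (n + a).+1)
    x k * (falling a.+1 (decr x k j) * stair_ratio n (n + a) (omit j (decr x k)))).
  by rewrite mulr_sumr; apply: eq_bigr => k _; ring.
rewrite sum_decr_falling // (IHa _ (decr_regular_omit jN x_reg)).
by rewrite (big_omit _ x jN) /= (binS a.+1 1) bin1 natrD; ring.
Qed.

(** * Alternants of arithmetic progressions *)

Section CenteredDifference.

Variable R : comNzRingType.

Lemma coef_XaddC_exp (c : R) e s :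
  (('X + c%:P) ^+ e)`_s = c ^+ (e - s) *+ 'C(e, s).
Proof.
rewrite addrC exprDn.
rewrite (_ : \sum_(i < e.+1) _ = \poly_(i < e.+1) (c ^+ (e - i) *+ 'C(e, i))).
  by rewrite coef_poly ltnS; case: leqP => // es; rewrite bin_small.
by rewrite poly_def; apply: eq_bigr => i _; rewrite -polyC_exp mul_polyC scalerMnl.
Qed.

Definition centered_diff (h : R) (e : nat) : {poly R} :=
  ('X + h%:P) ^+ e - ('X - h%:P) ^+ e.

Lemma horner_centered_diff h e z :
  (centered_diff h e).[z] = (z + h) ^+ e - (z - h) ^+ e.
Proof. by rewrite /centered_diff !hornerE. Qed.

Lemma coef_centered_diff h e s :
  (centered_diff h e)`_s = (h ^+ (e - s) - (- h) ^+ (e - s)) *+ 'C(e, s).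
Proof. by rewrite coefB coef_XaddC_exp -polyCN coef_XaddC_exp mulrnBl. Qed.

Lemma coef_centered_diff_eq0 h e s :
  ~~ odd (e - s) -> (centered_diff h e)`_s = 0.
Proof.
move=> es; rewrite coef_centered_diff exprNn -signr_odd (negbTE es).
by rewrite mul1r subrr mul0rn.
Qed.

Lemma size_centered_diff h e : (size (centered_diff h e) <= e)%N.
Proof.
apply/leq_sizeP => s; rewrite -subn_eq0 => /eqP es.
by rewrite coef_centered_diff_eq0 // es.
Qed.

(* The exponents of the staircase for n.+1 other than 0 exceed those of the
   staircase for n by 1, and centered differences change the parity. *)
Lemma stair_poly_centered_diff h n i :
  stair_poly n (centered_diff h (stair_exp n i).+1).
Proof.
move=> s ns odd_ns; rewrite coef_centered_diff_eq0 //.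
by move: odd_ns; rewrite /stair_exp; lia.
Qed.

End CenteredDifference.

Lemma det_diff_col (R : comPzRingType) N (A : 'M[R]_N.+1) :
    (forall j, A 0 j = 1) ->
  \det A = \det (\matrix_(i < N, j < N)
    (A (lift 0 i) (lift 0 j) - A (lift 0 i) (widen_ord (leqnSn N) j))).
Proof.
move=> A0; pose U : 'M[R]_N.+1 := \matrix_(i, j) ((i == j)%:R - (i.+1 == j)%:R).
have detU : \det U = 1.
  rewrite -det_tr det_trig.
    by rewrite big1 // => i _; rewrite !mxE eqxx eqn_leq ltnn subr0.
  apply/is_trig_mxP => i j ij; rewrite !mxE -val_eqE /=.
  by rewrite !gtn_eqF ?subr0 // ltnW.
have AU0 i : (A *m U) i 0 = A i 0.
  rewrite !mxE (bigD1 0) //= big1 => [|j j0].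
    by rewrite !mxE /= subr0 mulr1 addr0.
  by rewrite !mxE (negbTE j0) /= subr0 mulr0.
have AUS i j : (A *m U) i (lift 0 j) = A i (lift 0 j) - A i (widen_ord (leqnSn N) j).
  rewrite !mxE (bigD1 (lift 0 j)) //= (bigD1 (widen_ord (leqnSn N) j)) /=; last first.
    by rewrite -val_eqE /= /bump leq0n add1n neq_ltn ltnSn.
  rewrite big1 => [|k /andP[k1 k2]].
    rewrite !mxE eqxx -val_eqE /= /bump leq0n add1n eqxx.
    by rewrite (gtn_eqF (ltnSn _)) (ltn_eqF (ltnSn _)) subr0 sub0r mulr1 mulrN1 addr0.
  rewrite !mxE (negbTE k1) /= /bump leq0n add1n eqSS.
  by move: k2; rewrite -val_eqE /= => /negbTE->; rewrite subr0 mulr0.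
rewrite -[LHS]mulr1 -detU -det_mulmx (expand_det_row _ 0) big_ord_recl.
rewrite big1 => [|j _]; last by rewrite AUS !A0 subrr mul0r.
rewrite AU0 A0 mul1r addr0 /cofactor expr0 mul1r; congr (\det _).
by apply/matrixP => i j; rewrite !mxE -AUS !mxE.
Qed.

Definition progression (R : pzRingType) (c m : R) (i : nat) : R := c + m * i%:R.

Lemma altdet_progressionS (F : numFieldType) n N (c m : F) :
  altdet n.+1 N.+1 (progression c m) =
  m ^+ N * (\prod_(i < N) (stair_exp n i).+1)%:R
  * altdet n N (progression (c + m / 2) m).
Proof.
pose h := m / 2; pose y := progression (c + h) m.
rewrite /altdet det_diff_col => [|j]; last by rewrite mxE /stair_exp subSS sub0n.
pose p (i : 'I_N) := centered_diff h (stair_exp n i).+1.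
transitivity (\det (\matrix_(i < N, j < N) (p i).[y j])).
  congr (\det _); apply/matrixP => i j; rewrite !mxE horner_centered_diff.
  have -> : stair_exp n.+1 (lift 0 i) = (stair_exp n i).+1.
    by rewrite /stair_exp /= /bump; lia.
  congr (_ ^+ _ - _ ^+ _); rewrite /y /h /progression; last by ring.
  by rewrite /= /bump add1n -natr1; field.
rewrite (det_stair_poly (n := n)) => [|k|k].
- congr (_ * _); rewrite natr_prod -[in m ^+ N](card_ord N) -prodr_const -big_split.
  apply: eq_bigr => i _; rewrite coef_centered_diff binSn subSn // subnn.
  by rewrite !expr1 -mulr_natr /h /=; field.
- exact: stair_poly_centered_diff.
- exact: size_centered_diff.
Qed.

(* The leading coefficients collected by n rounds of centered differences. *)
Definition stair_prod (n a : nat) : nat :=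
  \prod_(t < n) \prod_(i < t + a) (stair_exp t i).+1.

Lemma altdet_progression (F : numFieldType) n a (c m : F) :
  altdet n (n + a) (progression c m) * m ^+ 'C(a, 2) =
  m ^+ 'C(n + a, 2) * (stair_prod n a)%:R
  * altdet 0 a (progression (c + m *+ n / 2) m).
Proof.
rewrite /stair_prod; elim: n c => [|n IHn] c.
  by rewrite big_ord0 mulr1 mulr0n mul0r addr0 mulrC.
rewrite addSn altdet_progressionS -!mulrA IHn big_ord_recr /= natrM.
rewrite (binS (n + a) 1) bin1 [m ^+ ('C(_, _) + _)]exprD.
have -> : c + m / 2 + m *+ n / 2 = c + m *+ n.+1 / 2 by rewrite mulrSr; field.
ring.
Qed.

Lemma PhiS k : Phi k.+1 = (Phi k * k`!)%N.
Proof. by rewrite /Phi; case: k => [|k]; [rewrite !big_geq | rewrite big_nat_recr]. Qed.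

Lemma Phi_gt0 k : (0 < Phi k)%N.
Proof. by apply: prodn_gt0 => i; apply: fact_gt0. Qed.

Lemma gimel_gt0 k : (0 < gimel k)%N.
Proof. by apply: prodn_gt0 => i; apply: fact_gt0. Qed.

Lemma gimelSS k : gimel k.+2 = (gimel k * k`!)%N.
Proof.
rewrite /gimel /= big_nat_recl //= mulnC muln1 subSS subn1; congr (_ * _)%N.
by apply: eq_bigr => i _; rewrite mulnS subSS subSS.
Qed.

Lemma Phi_gimel k : Phi k = (gimel k * gimel k.+1)%N.
Proof.
elim: k => [|k IHk]; first by rewrite /Phi /gimel !big_geq.
by rewrite PhiS IHk gimelSS mulnCA mulnA.
Qed.

Lemma gimel_stair_exp t a :
  (gimel (t + 2 * a).+1 * gimel t * \prod_(i < t + a) (stair_exp t i).+1 =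
   gimel (t + 2 * a).+2 * gimel t.+1)%N.
Proof.
elim: a => [|a IHa].
  rewrite muln0 !addn0 gimelSS -mulnA mulnC; congr (_ * _ * _)%N.
  rewrite fact_prod big_add1 big_mkord; apply: eq_bigr => i _.
  by rewrite /stair_exp; case: i => i /= it; lia.
have -> : (t + 2 * a.+1 = (t + 2 * a).+2)%N by ring.
rewrite addnS big_ord_recr /= !(gimelSS (t + 2 * a).+1) (gimelSS (t + 2 * a).+2).
rewrite [(t + 2 * a).+2`!]factS.
have -> : (stair_exp t (t + a)).+1 = (t + 2 * a).+2 by rewrite /stair_exp; lia.
transitivity ((gimel (t + 2 * a).+1 * gimel t * \prod_(i < t + a) (stair_exp t i).+1)
  * ((t + 2 * a).+2 * (t + 2 * a).+1`!))%N; first by ring.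
by rewrite IHa; ring.
Qed.

Lemma gimel_stair_prod n a :
  (gimel (2 * a).+1 * stair_prod n a = gimel n * gimel (n + 2 * a).+1)%N.
Proof.
rewrite /stair_prod; elim: n => [|n IHn].
  by rewrite big_ord0 muln1 /gimel [in RHS]big_geq // mul1n.
by rewrite big_ord_recr /= mulnA IHn (mulnC (gimel n)) gimel_stair_exp mulnC.
Qed.

Lemma Phi_gimel_stair_prod n a :
  (Phi (n + 2 * a) * gimel (2 * a) * gimel n =
   Phi (2 * a) * gimel (n + 2 * a) * stair_prod n a)%N.
Proof.
rewrite !Phi_gimel; transitivity
  (gimel (n + 2 * a) * gimel (2 * a) * (gimel n * gimel (n + 2 * a).+1))%N.
  by ring.
by rewrite -gimel_stair_prod; ring.
Qed.

Lemma pairdiff_progression (R : comNzRingType) N (c m : R) :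
  pairdiff N (progression c m) = m ^+ 'C(N, 2) * (Phi N)%:R.
Proof.
elim: N => [|N IHN].
  by rewrite /pairdiff /pairprod /Phi big_ord0 big_geq // mul1r.
rewrite /pairdiff pairprodS -/(pairdiff _ _) IHN PhiS (binS N 1) bin1 exprD natrM.
suff -> : \prod_(j < N) (progression c m N - progression c m j) =
    m ^+ N * N`!%:R by ring.
rewrite -ffactnn ffact_prod natr_prod -[in m ^+ N](card_ord N) -prodr_const -big_split.
apply: eq_bigr => j _; rewrite natrB ?(ltnW (ltn_ord _)) // /progression /=.
by ring.
Qed.

Lemma altdet_progression_ratio (F : numFieldType) n a (c m : F) : m != 0 ->
  let x := progression c m in
  altdet n (n + a) x / pairdiff (n + a) x =
  (stair_prod n a * Phi a)%:R / (2 ^+ a * (Phi (n + a))%:R)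
  * \prod_(i < a) \prod_(j < i.+1) (x (n + i)%N + x j).
Proof.
move=> m0 x; pose z := progression (c + m *+ n / 2) m.
have xz i j : x (n + i)%N + x j = z i + z j.
  by rewrite /x /z /progression natrD -mulr_natr; field.
have -> : \prod_(i < a) \prod_(j < i.+1) (x (n + i)%N + x j) =
    2 ^+ a * (\prod_(i < a) z i) * pairsum a z.
  rewrite -[in 2 ^+ a](card_ord a) -prodr_const -!big_split /=; apply: eq_bigr => i _.
  rewrite big_ord_recr /= mulrC xz; congr (_ * _); first by ring.
  by apply: eq_bigr => j _; rewrite xz.
have /(canRL (mulfK (expf_neq0 _ m0))) -> := altdet_progression n a c m.
rewrite altdet0 !pairdiff_progression natrM.
have two0 : (2 : F) != 0 by rewrite pnatr_eq0.
have Phi0 : (Phi (n + a))%:R != 0 :> F by rewrite pnatr_eq0 -lt0n Phi_gt0.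
by field; rewrite Phi0 !expf_neq0.
Qed.

(** * Standard Young tableaux *)

Definition cell_lt (c d : nat * nat) : bool :=
  (c.1 == d.1) && (c.2 < d.2)%N || (c.2 == d.2) && (c.1 < d.1)%N.

Definition corner (p : {fset nat * nat}) (c : nat * nat) : bool :=
  [forall d : p, ~~ cell_lt c (val d)].

Lemma cornerP (p : {fset nat * nat}) c :
  reflect (forall d, d \in p -> ~~ cell_lt c d) (corner p c).
Proof.
apply: (iffP forallP) => [pc d dp | pc d]; first exact: (pc [` dp]).
exact: pc (fsvalP d).
Qed.

Lemma is_SYTP (p : {fset nat * nat}) (t : {ffun p -> 'I_(#|` p|)}) :
  reflect (injective t /\
           forall c d : p, cell_lt (val c) (val d) -> (t c < t d)%N)
          (is_SYT t).
Proof.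
apply: (iffP and3P) => [[/injectiveP tI /forallP row_lt /forallP col_lt]|[tI tP]].
  split=> // c d /orP[]; first by have /forallP/(_ d)/implyP := row_lt c.
  by have /forallP/(_ d)/implyP := col_lt c.
split; first exact/injectiveP.
  apply/forallP => c; apply/forallP => d; apply/implyP => cd.
  by apply: tP; rewrite /cell_lt cd.
apply/forallP => c; apply/forallP => d; apply/implyP => cd.
by apply: tP; rewrite /cell_lt cd orbT.
Qed.

Lemma num_SYT_fset0 : num_SYT fset0 = 1%N.
Proof.
have no_cell (c : fset0 : {fset nat * nat}) : False by have := fsvalP c; rewrite inE.
apply/eqP/cards1P; exists [ffun c => False_rect _ (no_cell c)].
apply/setP => t; rewrite !inE; apply/is_SYTP/eqP => [_|_].
  by apply/ffunP => c; case: (no_cell c).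
by split=> c; case: (no_cell c).
Qed.

Section MaxEntry.

Variables (p : {fset nat * nat}) (c : p).

Let q := p `\ val c.
Let incl : q -> p := fincl (fsubD1set p (val c)).

Let card_p : #|` p| = #|` q|.+1.
Proof. by rewrite /q (cardfsD1 (val c) p) fsvalP. Qed.

Let lt_q_p : (#|` q| < #|` p|)%N. Proof. by rewrite card_p. Qed.
Let max_entry := Ordinal lt_q_p.

Let succ_eq_card (i : nat) : (i.+1 == #|` p|) = (i == #|` q|).
Proof. by rewrite card_p eqSS. Qed.

Lemma removed_or_incl (d : p) : d = c \/ exists d' : q, d = incl d'.
Proof.
have [->|dc] := eqVneq d c; [by left | right].
have dq : val d \in q by rewrite !inE fsvalP andbT.
by exists [` dq]; apply: val_inj.
Qed.

Lemma incl_neq (d' : q) : incl d' != c.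
Proof. by have := fsvalP d'; rewrite !inE => /andP[]. Qed.

Definition extend_SYT (u : {ffun q -> 'I_(#|` q|)}) : {ffun p -> 'I_(#|` p|)} :=
  [ffun d : p => if insub (val d) : option q is Some d'
                 then widen_ord (ltnW lt_q_p) (u d') else max_entry].

Lemma extend_SYT_incl u (d' : q) : extend_SYT u (incl d') = u d' :> nat.
Proof. by rewrite ffunE valK. Qed.

Lemma extend_SYT_max u : extend_SYT u c = #|` q| :> nat.
Proof. by rewrite ffunE insubF // !inE eqxx. Qed.

Lemma extend_SYT_inj : injective extend_SYT.
Proof.
move=> u v uv; apply/ffunP => d'; apply: val_inj => /=.
by rewrite -!extend_SYT_incl uv.
Qed.

Lemma extend_SYT_onto (t : {ffun p -> 'I_(#|` p|)}) :
  injective t -> t c = #|` q| :> nat -> exists u, t = extend_SYT u.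
Proof.
move=> tI tc; have lt_q (d' : q) : (t (incl d') < #|` q|)%N.
  have := ltn_ord (t (incl d')); rewrite [X in (_ < X)%N]card_p ltnS leq_eqVlt.
  case/predU1P => // td_max; have /eqP[] := incl_neq d'.
  by apply: tI; apply: val_inj; rewrite /= td_max tc.
exists [ffun d' => Ordinal (lt_q d')]; apply/ffunP => d; apply: val_inj => /=.
have [->|[d' ->]] := removed_or_incl d; first by rewrite extend_SYT_max.
by rewrite extend_SYT_incl ffunE.
Qed.

Lemma is_SYT_extend u : corner p (val c) -> is_SYT (extend_SYT u) = is_SYT u.
Proof.
move=> /cornerP c_corner; apply/is_SYTP/is_SYTP => [[tI tP]|[uI uP]].
  split=> [d e de|d e de]; last by rewrite -!extend_SYT_incl; apply: tP.
  apply: (@fincl_inj _ _ _ (fsubD1set p (val c))); apply: tI; apply: val_inj.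
  by rewrite /= !extend_SYT_incl de.
split=> d e.
  have [->|[d' ->]] := removed_or_incl d; have [->|[e' ->]] := removed_or_incl e => //;
    move/(congr1 val); rewrite /= ?extend_SYT_max ?extend_SYT_incl.
  - by move=> ue_max; have := ltn_ord (u e'); rewrite -ue_max ltnn.
  - by move=> ud_max; have := ltn_ord (u d'); rewrite ud_max ltnn.
  - by move=> /val_inj/uI->.
have [->|[d' ->]] := removed_or_incl d.
  by move=> ce; have := c_corner _ (fsvalP e); rewrite ce.
have [->|[e' ->]] := removed_or_incl e; rewrite ?extend_SYT_max extend_SYT_incl //.
by rewrite extend_SYT_incl; apply: uP.
Qed.

Lemma card_SYT_max : corner p (val c) ->
  #|[set t : {ffun p -> 'I_(#|` p|)} | is_SYT t && ((t c).+1 == #|` p|)]| =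
  num_SYT (p `\ val c).
Proof.
move=> c_corner; rewrite /num_SYT -(card_imset _ extend_SYT_inj).
congr #|pred_of_set _|; apply/setP => t; rewrite inE succ_eq_card.
apply/andP/imsetP => [[tS /eqP tc]|[u]]; last first.
  by rewrite inE => uS ->; rewrite is_SYT_extend // extend_SYT_max.
have [u tE] := extend_SYT_onto (is_SYTP _ tS).1 tc.
by exists u => //; rewrite inE -is_SYT_extend // -tE.
Qed.

Lemma card_SYT_max_not_corner : ~~ corner p (val c) ->
  #|[set t : {ffun p -> 'I_(#|` p|)} | is_SYT t && ((t c).+1 == #|` p|)]| = 0%N.
Proof.
case/forallPn => d; rewrite negbK => cd; apply: eq_card0 => t; rewrite !inE.
apply/negbTE/negP => /andP[/is_SYTP[_ /(_ c d cd)] tcd /eqP tc].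
by have := ltn_ord (t d); rewrite -[X in (_ < X)%N]tc ltnS leqNgt tcd.
Qed.

End MaxEntry.

(* Sort the tableaux by the cell that holds the largest entry. *)
Lemma num_SYT_rec (p : {fset nat * nat}) : p != fset0 ->
  num_SYT p = \sum_(c <- p | corner p c) num_SYT (p `\ c).
Proof.
rewrite -cardfs_gt0 => p_gt0; rewrite big_seq_fsetE /=.
have lt_p : (#|` p|.-1 < #|` p|)%N by rewrite prednK.
pose top := Ordinal lt_p.
transitivity (\sum_(c : p)
  #|[set t : {ffun p -> 'I_(#|` p|)} | is_SYT t && ((t c).+1 == #|` p|)]|)%N.
  under eq_bigr => c _ do rewrite -sum1dep_card.
  rewrite (exchange_big_dep (@is_SYT p)) /=; last by move=> c t _ /andP[].
  rewrite /num_SYT -sum1dep_card; apply: eq_bigr => t tS; have [tI _] := is_SYTP _ tS.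
  have [g tK gK] : bijective t by apply: inj_card_bij; rewrite // card_ord -cardfE.
  rewrite (bigD1 (g top)) /=; last by rewrite gK /= prednK // eqxx andbT.
  rewrite big1 ?addn0 // => c /andP[/andP[_ /eqP cE]] /negP[].
  by apply/eqP; rewrite -(tK c); congr g; apply: val_inj; exact: (congr1 predn cE).
rewrite [RHS]big_mkcond; apply: eq_bigr => c _; case: ifP => c_corner.
  by rewrite card_SYT_max.
by rewrite card_SYT_max_not_corner ?c_corner.
Qed.

(** * Shifted staircase shapes *)

Lemma mem_shifted_diagram nu i j :
  ((i, j) \in shifted_diagram nu) =
  (0 < i <= size nu)%N && (i <= j < i + part nu i)%N.
Proof.
rewrite !inE; apply/allpairsPdep/andP => [[k [l [kn ln [-> ->]]]] | [iN ij]].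
  by move: kn ln; rewrite !mem_iota add1n ltnS.
by exists i, j; rewrite !mem_iota add1n ltnS.
Qed.

Lemma uniq_shifted_cells nu :
  uniq [seq (i, j) | i <- iota 1 (size nu), j <- iota i (part nu i)].
Proof.
by apply: allpairs_uniq_dep => [|i _|[i j] [k l] _ _ /= [-> ->] //]; apply: iota_uniq.
Qed.

Lemma prod_shifted_diagram (R : comPzRingType) nu (f : nat * nat -> R) :
  \prod_(c <- shifted_diagram nu) f c =
  \prod_(i <- iota 1 (size nu)) \prod_(j <- iota i (part nu i)) f (i, j).
Proof.
rewrite -big_allpairs_dep; apply: perm_big.
by apply: uniq_perm; rewrite ?fset_uniq ?uniq_shifted_cells // => c; rewrite !inE.
Qed.

Lemma card_shifted_diagram nu : #|` shifted_diagram nu| = sumn nu.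
Proof.
rewrite card_fseq undup_id ?uniq_shifted_cells // size_allpairs_dep.
congr sumn; apply: (@eq_from_nth _ 0%N); rewrite ?size_map ?size_iota // => i iN.
by rewrite (nth_map 0%N) ?size_iota // nth_iota // add1n.
Qed.

Definition parts (N : nat) (y : nat -> nat) : seq nat :=
  [seq y (N - k)%N | k <- iota 1 N].

Lemma size_parts N y : size (parts N y) = N.
Proof. by rewrite size_map size_iota. Qed.

Lemma part_parts N y i : (0 < i <= N)%N -> part (parts N y) i = y (N - i)%N.
Proof.
case: i => // i /andP[_ iN].
by rewrite /part (nth_map 0%N) ?size_iota //= nth_iota.
Qed.

Lemma sumn_parts N y : sumn (parts N y) = (\sum_(i < N) y i)%N.
Proof.
rewrite sumnE big_map big_iota_rev; apply: eq_bigr => i _.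
by rewrite add1n subSS subKn // ltnW.
Qed.

Lemma deltaE k : delta k = parts k id.
Proof. by []. Qed.

Definition stair_shape (N a : nat) (y : nat -> nat) : {fset nat * nat} :=
  shifted_skew (parts N y) (delta a.+1).

Lemma mem_stair_shape N a y i j :
  ((i, j) \in stair_shape N a y) =
  (0 < i <= N)%N && (maxn i a.+1 <= j < i + y (N - i))%N.
Proof.
rewrite /stair_shape /shifted_skew deltaE in_fsetD !mem_shifted_diagram !size_parts.
case: (boolP (0 < i <= N)%N) => iN; last by rewrite andbF.
rewrite (part_parts _ iN).
case: (leqP i a.+1) => ia; last by lia.
by rewrite part_parts; lia.
Qed.

Definition strict_pos (N : nat) (y : nat -> nat) : Prop :=
  (forall i, (i < N)%N -> (0 < y i)%N) /\
  (forall i, (i.+1 < N)%N -> (y i < y i.+1)%N).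

Lemma strict_pos_gap N y i j : strict_pos N y -> (i <= j)%N -> (j < N)%N ->
  (y i + (j - i) <= y j)%N.
Proof.
move=> [_ yS]; elim: j => [|j IHj]; first by case: i => // _ _; rewrite subnn addn0.
rewrite leq_eqVlt => /predU1P[->|]; first by rewrite subnn addn0.
rewrite ltnS => ij jN; have := yS j jN; have := IHj ij (ltnW jN); lia.
Qed.

Lemma strict_pos_lt N y i j : strict_pos N y -> (i < j < N)%N -> (y i < y j)%N.
Proof. by move=> yP /andP[ij jN]; have := strict_pos_gap yP (ltnW ij) jN; lia. Qed.

Lemma strict_pos_gt_id N y j : strict_pos N y -> (j < N)%N -> (j < y j)%N.
Proof.
move=> yP jN; have := strict_pos_gap yP (leq0n j) jN.
have := yP.1 0%N (leq_ltn_trans (leq0n j) jN); lia.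
Qed.

Lemma card_stair_shape N a y : strict_pos N y -> (a <= N)%N ->
  (#|` stair_shape N a y| + 'C(a.+1, 2) = \sum_(i < N) y i)%N.
Proof.
move=> yP aN; rewrite -bin2_sum big_mkord -(sumn_parts a.+1 id) -sumn_parts.
rewrite -deltaE -!card_shifted_diagram /stair_shape /shifted_skew.
suff sub : shifted_diagram (delta a.+1) `<=` shifted_diagram (parts N y).
  by rewrite cardfsDS // subnK // fsubset_leq_card.
apply/fsubsetP => -[i j]; rewrite deltaE !mem_shifted_diagram !size_parts.
move=> /andP[ia]; rewrite part_parts // => ij.
have iN : (0 < i <= N)%N by lia.
by rewrite part_parts // iN; have := @strict_pos_gt_id N y (N - i) yP; lia.
Qed.

Definition row_end (N : nat) (y : nat -> nat) (k : nat) : nat * nat :=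
  ((N - k)%N, (N - k + y k).-1%N).

(* For n = 0 the first cell of the bottom row lies in the removed staircase. *)
Definition removable (n : nat) (y : nat -> nat) (k : nat) : bool :=
  if k is k'.+1 then ((y k').+1 < y k)%N else (1 < n + y 0%N)%N.

Definition decrn (y : nat -> nat) (k i : nat) : nat := (y i - (i == k))%N.

Lemma decrn_same y k : decrn y k k = (y k).-1.
Proof. by rewrite /decrn eqxx subn1. Qed.

Lemma decrn_neq y k i : i != k -> decrn y k i = y i.
Proof. by rewrite /decrn => /negbTE->; rewrite subn0. Qed.

Section Corners.

Variables (n a : nat) (y : nat -> nat).
Hypothesis yP : strict_pos (n + a) y.

Let N := (n + a)%N.
Let p := stair_shape N a y.

Lemma mem_row_end k : (k < N)%N -> removable n y k -> row_end N y k \in p.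
Proof.
move=> kN; have yk := strict_pos_gt_id yP kN.
rewrite mem_stair_shape subKn ?(ltnW kN) //.
case: k kN yk => [|k] /= kN yk kr; first by lia.
by have := @strict_pos_gt_id _ y k yP; lia.
Qed.

Lemma corner_row_end k : (k < N)%N -> row_end N y k \in p ->
  corner p (row_end N y k) = removable n y k.
Proof.
move=> kN; rewrite mem_stair_shape subKn ?(ltnW kN) // => /andP[_ jk].
have yk := strict_pos_gt_id yP kN.
apply/cornerP/idP => [c_corner | kr [i j]].
  case: k kN jk yk c_corner => [|k] kN jk yk c_corner /=; first by lia.
  have [yk0 ykS] := (yP.1 k (ltnW kN), yP.2 k kN).
  rewrite ltnNge; apply/negP => yk1.
  have /c_corner : ((N - k)%N, (N - k.+1 + y k.+1).-1) \in p.
    by rewrite mem_stair_shape subKn ?(ltnW (ltnW kN)) //; lia.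
  by rewrite /cell_lt /= eqxx /=; lia.
rewrite mem_stair_shape /cell_lt /= => /andP[iN ij].
apply/negP => /orP[/andP[/eqP ik jj]|/andP[/eqP jj ik]].
  by move: ij; rewrite -ik subKn ?(ltnW kN) //; lia.
case: k kN kr jj ik {jk} yk => [|k] kN /= kr jj ik yk; first by lia.
by have := @strict_pos_gap _ y (N - i) k yP; lia.
Qed.

Lemma corner_eq_row_end c : c \in p -> corner p c -> c = row_end N y (N - c.1).
Proof.
case: c => i j; rewrite mem_stair_shape => /andP[iN ij] /cornerP/(_ (i, j.+1)).
rewrite mem_stair_shape iN /cell_lt /= eqxx ltnSn /= => right_notin.
have -> : j = (i + y (N - i)).-1.
  by apply/eqP; apply: contraT => j_neq; apply: right_notin; lia.
by rewrite /row_end subKn //; lia.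
Qed.

Lemma sum_corners (G : nat * nat -> nat) :
  (\sum_(c <- p | corner p c) G c =
   \sum_(k < N | removable n y k) G (row_end N y k))%N.
Proof.
rewrite -(big_mkord (removable n y) (fun k => G (row_end _ y k))).
rewrite -[RHS]big_filter -(big_map (row_end _ y) xpredT) -[LHS]big_filter.
apply: perm_big; apply: uniq_perm => [||c]; first by rewrite filter_uniq // fset_uniq.
  rewrite map_inj_in_uniq ?filter_uniq ?iota_uniq // => k l.
  by rewrite !mem_filter !mem_iota /= => kN lN [rowE _]; lia.
rewrite mem_filter; apply/andP/mapP => [[c_corner cp]|[k]].
  have cE := corner_eq_row_end cp c_corner; exists (N - c.1)%N => //.
  have kN : (N - c.1 < N)%N.
    by move: cp; rewrite {1}(surjective_pairing c) mem_stair_shape; lia.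
  by rewrite mem_filter mem_index_iota -corner_row_end -?cE // c_corner kN.
rewrite mem_filter mem_index_iota => /andP[kr kN] ->.
by have cp := mem_row_end kN kr; rewrite corner_row_end.
Qed.

Lemma stair_shape_remove k : (k < N)%N ->
  p `\ row_end N y k = stair_shape N a (decrn y k).
Proof.
move=> kN; have yk := yP.1 k kN; apply/fsetP => -[i j].
rewrite in_fsetD1 !mem_stair_shape /row_end xpair_eqE.
case iN: (0 < i <= N)%N; last by rewrite andbF.
have [ik|ik] := eqVneq (N - i)%N k; first by rewrite ik decrn_same -ik subKn; lia.
by rewrite decrn_neq //; have -> : (i == N - k)%N = false by lia.
Qed.

Lemma strict_pos_decrn k : (k < N)%N -> removable n y k -> (1 < y k)%N ->
  strict_pos N (decrn y k).
Proof.
move=> kN kr yk; split=> i iN; rewrite /decrn.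
  by have := yP.1 i iN; case: eqP => [->|]; lia.
have := yP.2 i iN; have := yP.1 i; case: eqP => [ik|]; case: eqP => [iSk|]; try lia.
by move: kr; rewrite -iSk /=; lia.
Qed.

End Corners.

Lemma stair_shape_col0 N a y : y 0%N = 0%N ->
  stair_shape N.+1 a y = stair_shape N a (y \o succn).
Proof.
move=> y0; apply/fsetP => -[i j]; rewrite !mem_stair_shape.
case: (leqP i N) => iN; first by rewrite subSn // (leqW iN).
rewrite andbF; case: (leqP i N.+1) => iN1; last by rewrite andbF.
have -> : i = N.+1 by lia.
by rewrite subnn y0 addn0; lia.
Qed.

Lemma stair_shape_eq0 n a y : strict_pos (n + a) y ->
  stair_shape (n + a) a y = fset0 -> n = 0%N /\ forall i, (i < a)%N -> y i = i.+1.
Proof.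
move=> yP p0; have last_row i : (i < n + a)%N -> n = 0%N /\ y i = i.+1.
  move=> iN; have top : ((n + a).-1 < n + a)%N by lia.
  have : (1%N, y (n + a).-1) \notin stair_shape (n + a) a y by rewrite p0 inE.
  rewrite mem_stair_shape subn1; have := strict_pos_gt_id yP top.
  by have := strict_pos_gt_id yP iN; have := @strict_pos_gap _ y i (n + a).-1 yP; lia.
have n0 : n = 0%N by case: n last_row {yP p0} => // n /(_ 0%N isT)[].
by split=> // i ia; apply: (last_row _ _).2; rewrite n0.
Qed.

(** * The number of tableaux *)

(* By num_SYT_stair, the proportion of the bijective fillings of
   stair_shape N a y that are standard, for N = n + a. *)
Definition stair_density (n N : nat) (y : nat -> nat) : rat :=
  stair_ratio n N (fun i => (y i)%:R) / \prod_(i < N) (y i)`!%:R.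

Lemma prod_fact_neq0 (F : numFieldType) N (y : nat -> nat) :
  \prod_(i < N) (y i)`!%:R != 0 :> F.
Proof. by apply/prodf_neq0 => i _; rewrite pnatr_eq0 -lt0n fact_gt0. Qed.

Lemma eq_stair_density n N y z :
  (forall i, (i < N)%N -> y i = z i) -> stair_density n N y = stair_density n N z.
Proof.
move=> yz; congr (_ / _); last by apply: eq_bigr => i _; rewrite yz.
by apply: eq_stair_ratio => i iN; rewrite yz.
Qed.

Lemma stair_density_succ a : stair_density 0 a succn = 1.
Proof.
have pairsum0 : pairsum a (fun i => i.+1%:R) != 0 :> rat.
  by apply/pairprod_neq0P => i j _; rewrite -natrD pnatr_eq0.
rewrite /stair_density stair_ratio0 // -big_split /=.
rewrite (eq_bigr (fun i : 'I_a => (i.+1)`!%:R : rat)) ?divff ?prod_fact_neq0 // => i _.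
rewrite factS natrM -ffactnn ffact_prod natr_prod; congr (_ * _).
by apply: eq_bigr => j _; rewrite -natrB ?ltnS ?(ltnW (ltn_ord _)).
Qed.

Lemma stair_densityS_col0 n N y :
    y 0%N = 0%N -> (forall i, (i < N)%N -> (0 < y i.+1)%N) ->
  stair_density n.+1 N.+1 y = stair_density n N (y \o succn).
Proof.
move=> y0 y_gt0; rewrite /stair_density stair_ratioS_col0 ?y0 // => [|i /y_gt0].
  by rewrite big_ord_recl /= y0 fact0 mul1r.
by rewrite pnatr_eq0 lt0n.
Qed.

Lemma decrn_natr (R : pzRingType) y k i : (0 < y k)%N ->
  (decrn y k i)%:R = decr (fun i => (y i)%:R) k i :> R.
Proof.
move=> yk; have [->|ik] := eqVneq i k; last by rewrite decrn_neq // decr_neq.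
by rewrite decrn_same decr_same -subn1 natrB.
Qed.

Lemma decr_regular_natr (F : numFieldType) N y : strict_pos N y ->
  decr_regular N (fun i => (y i)%:R : F).
Proof.
move=> yP; have y_gt0 i : (i < N)%N -> (0 < y i)%N by apply: yP.1.
split=> [||k kN]; apply/pairprod_neq0P => i j ji.
- by rewrite subr_eq0 eqr_nat; have := strict_pos_lt yP ji; lia.
- by rewrite -natrD pnatr_eq0; have := y_gt0 i; lia.
rewrite -!decrn_natr ?y_gt0 // -natrD pnatr_eq0 /decrn.
by have := strict_pos_lt yP ji; have := @y_gt0 j; lia.
Qed.

Lemma stair_density_decrn_eq0 n a y k : strict_pos (n + a) y -> (k < n + a)%N ->
  ~~ removable n y k -> stair_density n (n + a) (decrn y k) = 0.
Proof.
move=> yP kN kr; rewrite /stair_density /stair_ratio.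
suff -> : altdet n (n + a) (fun i => (decrn y k i)%:R : rat) = 0 by rewrite !mul0r.
case: k kN kr => [|k] kN /=; rewrite -leqNgt => yk.
  have [n0 y0] : n = 0%N /\ y 0%N = 1%N by have := yP.1 0%N kN; lia.
  rewrite n0 add0n in kN *; rewrite altdet0 (bigD1 (Ordinal kN)) //=.
  by rewrite decrn_same y0 !mul0r.
apply: (@altdet_eq_col _ _ _ _ k k.+1); first by rewrite ltnSn.
by rewrite decrn_same decrn_neq ?ltn_eqF //; congr _%:R; have := yP.2 k kN; lia.
Qed.

Lemma stair_density_rec n a y : strict_pos (n + a) y ->
  #|` stair_shape (n + a) a y|%:R * stair_density n (n + a) y =
  \sum_(k < n + a | removable n y k) stair_density n (n + a) (decrn y k).
Proof.
move=> yP; have := card_stair_shape yP (leq_addl n a).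
move/(congr1 (fun s => s%:R : rat)); rewrite natrD natr_sum => /(canRL (addrK _)) ->.
rewrite /stair_density mulrA -(stair_ratio_eigen (decr_regular_natr _ yP)).
rewrite mulr_suml [RHS]big_mkcond; apply: eq_bigr => k _.
have yk : (0 < y k)%N := yP.1 k (ltn_ord k).
have factE : \prod_(i < n + a) (y i)`!%:R =
    (y k)%:R * \prod_(i < n + a) (decrn y k i)`!%:R :> rat.
  rewrite (bigD1 k) //= [in RHS](bigD1 k) //= mulrA decrn_same -natrM.
  rewrite -{2}(prednK yk) -factS prednK //; congr (_ * _).
  by apply: eq_bigr => i ik; rewrite decrn_neq.
transitivity (stair_density n (n + a) (decrn y k)); last first.
  by case: ifPn => // kr; apply: stair_density_decrn_eq0.
rewrite factE /stair_density (@eq_stair_ratio _ _ _ (decr _ k)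
  (fun i => (decrn y k i)%:R)) => [|i _]; last by rewrite decrn_natr.
have yk0 : (y k)%:R != 0 :> rat by rewrite pnatr_eq0 -lt0n.
by field; rewrite prod_fact_neq0 yk0.
Qed.

(* A row of length 1 is the bottom row; removing its cell leaves one row fewer. *)
Lemma removable_single n a y k : strict_pos (n + a) y -> (k < n + a)%N ->
    removable n y k -> (y k <= 1)%N ->
  exists n', [/\ n = n'.+1, strict_pos (n' + a) (decrn y k \o succn)
               & decrn y k 0 = 0%N].
Proof.
move=> yP kN kr yk; have k0 : k = 0%N by have := strict_pos_gt_id yP kN; lia.
rewrite k0 in kr yk kN *; have y0 := yP.1 0%N kN.
case: n yP kr {kN} => [|n] yP /= kr; first by lia.
exists n; rewrite decrn_same; split=> //; last by lia.
split=> i iN; rewrite /= !decrn_neq //; first exact: yP.1.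
exact: yP.2.
Qed.

Lemma num_SYT_stair n a y : strict_pos (n + a) y ->
  (num_SYT (stair_shape (n + a) a y))%:R =
  (#|` stair_shape (n + a) a y|)`!%:R * stair_density n (n + a) y.
Proof.
move Es : #|` stair_shape (n + a) a y| => s; elim: s n y Es => [|s IHs] n y Es yP.
  have p0 : stair_shape (n + a) a y = fset0 by apply: cardfs0_eq.
  have [n0 yE] := stair_shape_eq0 yP p0; rewrite p0 num_SYT_fset0 mul1r n0.
  by rewrite (eq_stair_density _ yE) stair_density_succ.
have p_neq0 : stair_shape (n + a) a y != fset0 by rewrite -cardfs_gt0 Es.
rewrite num_SYT_rec // sum_corners // natr_sum factS mulnC natrM -mulrA -Es.
rewrite stair_density_rec // mulr_sumr.
apply: eq_bigr => -[k kN] /= kr.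
have cardE : #|` stair_shape (n + a) a (decrn y k)| = s.
  rewrite -stair_shape_remove //; apply/eqP; rewrite -eqSS -Es.
  by rewrite (cardfsD1 (row_end (n + a) y k) (stair_shape _ _ _)) mem_row_end.
rewrite stair_shape_remove //; case: (ltnP 1 (y k)) => yk.
  by apply: IHs => //; apply: strict_pos_decrn kr yk.
have [n' [n'E dP d0]] := removable_single yP kN kr yk; move: cardE.
rewrite n'E addSn stair_shape_col0 // stair_densityS_col0 //; last exact: dP.1.
by move=> cardE; apply: IHs.
Qed.

(** * Hook lengths *)

(* The hooks of a row of length M whose lower rows have lengths
   m (k - 1) >= ... >= m 0, together with the numbers M + k - m l - l,
   are exactly 1, ..., M + k. *)
Lemma prod_hook_row k (m : nat -> nat) M :
    (forall i j, (i <= j < k)%N -> (m i <= m j)%N) ->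
    (forall i, (i < k)%N -> (m i <= M)%N) ->
  ((\prod_(t < M) (M - t + \sum_(l < k) (t < m l)))
   * \prod_(l < k) (M + k - m l - l) = (M + k)`!)%N.
Proof.
elim: k M => [|k IHk] M m_mono m_le.
  rewrite big_ord0 muln1 addn0 -ffactnn ffact_prod; apply: eq_bigr => t _.
  by rewrite big_ord0 addn0.
have mk : (m k <= M)%N by apply: m_le.
pose h M' k' t := (M' - t + \sum_(l < k') (t < m l))%N.
have split_mk M' k' : (m k <= M')%N ->
    (\prod_(t < M') h M' k' t =
     \prod_(0 <= t < m k) h M' k' t * \prod_(m k <= t < M') h M' k' t)%N.
  by move=> mkM; rewrite -big_cat_nat // big_mkord.
have short t : (t < m k)%N -> h M k.+1 t = h M.+1 k t.
  by move=> tk; rewrite /h big_ord_recr /= tk; lia.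
have long M' k' t : (m k <= t)%N -> (k' <= k.+1)%N -> h M' k' t = (M' - t)%N.
  move=> kt k'k; rewrite /h big1 ?addn0 // => l _.
  by rewrite ltnNge (leq_trans _ kt) // m_mono //; have := ltn_ord l; lia.
have prod_long M' k' : (k' <= k.+1)%N ->
    (\prod_(m k <= t < M') h M' k' t = \prod_(m k <= t < M') (M' - t))%N.
  by move=> k'k; rewrite !big_nat; apply: eq_bigr => t /andP[kt _]; apply: long.
rewrite -addSnnS -(IHk M.+1); first last.
- by move=> l lk; rewrite (leq_trans (m_le l _)) // ltnW.
- by move=> i j ij; apply: m_mono; lia.
rewrite big_ord_recr /= mulnA mulnAC; congr (_ * _)%N.
rewrite (split_mk M k.+1) // (split_mk M.+1 k) ?(leqW mk) // !prod_long //.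
rewrite [in RHS](@big_ltn _ _ _ (m k)) // big_add1 /= -mulnA [X in (_ * X)%N]mulnC.
congr (_ * (_ * _))%N; last by lia.
by rewrite !big_nat; apply: eq_bigr => t /short.
Qed.

Local Arguments shifted_hook : simpl never.

Lemma part_unshift N y i : (0 < i <= N)%N ->
  part (unshift (parts N y)) i = (y (N - i) - (N - i).+1)%N.
Proof.
case: i => // i /andP[_ iN]; rewrite /unshift size_parts deltaE {1}/part.
rewrite (nth_map 0%N) ?size_iota // nth_iota // add1n.
by rewrite !part_parts ?subSn //; lia.
Qed.

Lemma conj_part_unshift N y t : conj_part (unshift (parts N y)) t =
  (\sum_(l < N) (t <= y l - l.+1))%N.
Proof.
rewrite /conj_part -sum1_count /unshift size_parts big_map big_mkcond big_iota_rev.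
apply: eq_bigr => l _; have lN := ltn_ord l; rewrite add1n subSS deltaE.
rewrite !part_parts; try by lia.
have -> : (N - (N - l) = l)%N by lia.
have -> : (N.+1 - (N - l) = l.+1)%N by lia.
by case: leq.
Qed.

Section ShiftedHooks.

Variables (N : nat) (y : nat -> nat).
Hypothesis yP : strict_pos N y.

Let la := parts N y.

Lemma shifted_hook_diag k : (k < N)%N ->
  shifted_hook la (N - k, N - k)%N = y k.
Proof.
move=> kN; rewrite /shifted_hook eqxx size_parts part_unshift; last by lia.
by have := strict_pos_gt_id yP kN; rewrite subKn; lia.
Qed.

Lemma shifted_hook_pair k l : (l < k < N)%N ->
  shifted_hook la (N - k, N - l)%N = (y k + y l)%N.
Proof.
move=> lkN; rewrite /shifted_hook size_parts.
have -> : (N - k == N - l)%N = false by lia.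
rewrite leq_subr !part_unshift; try by lia.
have := @strict_pos_gt_id N y k yP; have := @strict_pos_gt_id N y l yP.
by rewrite !subKn; lia.
Qed.

Lemma shifted_hook_free k t : (k < N)%N -> (t < y k - k.+1)%N ->
  shifted_hook la (N - k, N.+1 + t)%N =
  (y k - k.+1 - t + \sum_(l < k) (t < y l - l.+1))%N.
Proof.
move=> kN tk; rewrite /shifted_hook size_parts.
have -> : (N - k == N.+1 + t)%N = false by lia.
have -> : (N.+1 + t <= N)%N = false by lia.
have -> : (N.+1 + t - N = t.+1)%N by lia.
rewrite /hook part_unshift ?conj_part_unshift; last by lia.
rewrite -(big_mkord xpredT (fun l => (t < y l - l.+1)%N : nat)).
rewrite (big_cat_nat (n := k)) ?(ltnW kN) //= big_mkord.
have -> : (\sum_(k <= l < N) (t < y l - l.+1) = N - k)%N.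
  rewrite big_nat (eq_bigr (fun=> 1%N)) => [|l /andP[kl lN]].
    by rewrite -big_nat sum_nat_const_nat muln1.
  by have gap := strict_pos_gap yP kl lN; have -> : (t < y l - l.+1)%N by lia.
by rewrite subKn ?(ltnW kN) //=; move: (\sum_(l < k) _)%N => S; lia.
Qed.

Lemma prod_shifted_hook_pair k : (k < N)%N ->
  (\prod_((N - k).+1 <= j < N.+1) shifted_hook la ((N - k)%N, j) =
   \prod_(l < k) (y k + y l))%N.
Proof.
move=> kN; have -> : index_iota (N - k).+1 N.+1 = iota (N - k).+1 k.
  by rewrite /index_iota; congr iota; lia.
rewrite big_iota_rev; apply: eq_bigr => l _; rewrite -shifted_hook_pair ?ltn_ord //.
by congr (shifted_hook _ (_, _)); have := ltn_ord l; lia.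
Qed.

Lemma prod_shifted_hook_free k : (k < N)%N ->
  ((\prod_(N.+1 <= j < N - k + y k) shifted_hook la ((N - k)%N, j))
   * \prod_(l < k) (y k - y l) = (y k).-1`!)%N.
Proof.
move=> kN; have yk := strict_pos_gt_id yP kN.
have ge l : (l < k)%N -> (l < y l)%N by move=> lk; apply: strict_pos_gt_id yP _; lia.
have gap i j : (i <= j <= k)%N -> (y i + (j - i) <= y j)%N.
  by move=> ij; apply: (strict_pos_gap yP); lia.
have -> : (y k).-1 = (y k - k.+1 + k)%N by lia.
rewrite -(@prod_hook_row k (fun l => y l - l.+1)%N) => [|i j ij|i ik].
- congr (_ * _)%N.
    rewrite -{1}[N.+1]add0n big_addn.
    have -> : (N - k + y k - N.+1 = y k - k.+1)%N by lia.
    rewrite big_mkord; apply: eq_bigr => t _.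
    by rewrite -shifted_hook_free // addnC.
  by apply: eq_bigr => l _; have := ge l (ltn_ord l); have := ltn_ord l; lia.
- by have := gap i j; have := ge i; lia.
- by have := gap i k; lia.
Qed.

Lemma prod_shifted_hook_row k : (k < N)%N ->
  ((\prod_(j <- iota (N - k) (y k)) shifted_hook la ((N - k)%N, j))
   * \prod_(l < k) (y k - y l) = (y k)`! * \prod_(l < k) (y k + y l))%N.
Proof.
move=> kN; have yk := strict_pos_gt_id yP kN.
have -> : iota (N - k) (y k) = index_iota (N - k) (N - k + y k).
  by rewrite /index_iota addKn.
rewrite (big_cat_nat (n := N.+1)) /=; try by lia.
rewrite -mulnA prod_shifted_hook_free // big_ltn; last by lia.
rewrite shifted_hook_diag // prod_shifted_hook_pair //.
by case: (y k) yk => // z _; rewrite factS mulnAC.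
Qed.

Lemma prod_shifted_hook (F : numFieldType) :
  (\prod_(c <- shifted_diagram la) (shifted_hook la c)%:R)
  * pairdiff N (fun i => (y i)%:R) =
  (\prod_(i < N) (y i)`!%:R) * pairsum N (fun i => (y i)%:R) :> F.
Proof.
rewrite prod_shifted_diagram size_parts big_iota_rev -!big_split.
apply: eq_bigr => k _ /=; have kN := ltn_ord k.
rewrite add1n subSS part_parts ?subKn //; try by lia.
have /(congr1 (fun z => z%:R : F)) := prod_shifted_hook_row kN.
rewrite !natrM !natr_prod => rowE; transitivity
  ((\prod_(j <- iota (N - k) (y k)) (shifted_hook la ((N - k)%N, j))%:R)
   * \prod_(l < k) (y k - y l)%:R : F).
  congr (_ * _); apply: eq_bigr => l _; rewrite natrB // ltnW //.
  by apply: strict_pos_lt yP _; rewrite ltn_ord.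
by rewrite rowE; congr (_ * _); apply: eq_bigr => l _; rewrite natrD.
Qed.

Lemma prod_shifted_hook_neq0 (F : numFieldType) :
  \prod_(c <- shifted_diagram la) (shifted_hook la c)%:R != 0 :> F.
Proof.
have [_ s0 _] := decr_regular_natr F yP.
have : \prod_(i < N) (y i)`!%:R * pairsum N (fun i => (y i)%:R) != 0 :> F.
  by rewrite mulf_neq0 // prod_fact_neq0.
by rewrite -prod_shifted_hook mulf_eq0 negb_or => /andP[].
Qed.

End ShiftedHooks.

Lemma num_SYT_stair_hook n a y : strict_pos (n + a) y ->
  let la := parts (n + a) y in
  let x i : rat := (y i)%:R in
  (num_SYT (stair_shape (n + a) a y))%:R =
  (#|` stair_shape (n + a) a y|)`!%:R * (altdet n (n + a) x / pairdiff (n + a) x)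
  / \prod_(c <- shifted_diagram la) (shifted_hook la c)%:R.
Proof.
move=> yP la x; have hookE := prod_shifted_hook yP rat.
rewrite num_SYT_stair // /stair_density /stair_ratio -!mulrA -!invfM.
by congr (_ * (_ / _)); rewrite mulrC -hookE mulrC.
Qed.

Lemma mem_Dcells n a i j :
  ((i, j) \in Dcells n a) = (0 < i <= a)%N && (n + i <= j <= n + a)%N.
Proof.
rewrite !inE; apply/allpairsPdep/andP => [[k [l [kn ln [-> ->]]]] | [iN ij]].
  by move: kn ln; rewrite !mem_iota; lia.
by exists i, (j - n)%N; rewrite !mem_iota; split; try (congr pair); lia.
Qed.

Lemma prod_Dcells (R : comPzRingType) n a (f : nat * nat -> R) :
  \prod_(c <- Dcells n a) f c =
  \prod_(k < a) \prod_(l < k.+1) f ((a - k)%N, (n + a - l)%N).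
Proof.
have cellsE : perm_eq (Dcells n a)
    [seq (i, (n + j)%N) | i <- iota 1 a, j <- iota i (a + 1 - i)].
  apply: uniq_perm => [||c]; [exact: fset_uniq | | by rewrite !inE].
  by apply: allpairs_uniq_dep => [|i _|[i j] [k l] _ _ /= [-> /addnI->] //];
    apply: iota_uniq.
rewrite (perm_big _ cellsE) big_allpairs_dep big_iota_rev; apply: eq_bigr => k _.
have ka := ltn_ord k.
rewrite add1n subSS big_iota_rev.
have -> : (a + 1 - (a - k) = k.+1)%N by lia.
by apply: eq_bigr => l _; congr (f (_, _)); have := ltn_ord l; lia.
Qed.

Section DroppedHooks.

Variables (n a : nat) (y : nat -> nat).
Hypothesis yP : strict_pos (n + a) y.

Let la := parts (n + a) y.

Lemma Dcells_sub : Dcells n a `<=` shifted_diagram la.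
Proof.
apply/fsubsetP => -[i j]; rewrite mem_Dcells mem_shifted_diagram size_parts.
move=> /andP[ia ja]; have iN : (0 < i <= n + a)%N by lia.
by rewrite part_parts // iN; have := @strict_pos_gt_id _ y (n + a - i) yP; lia.
Qed.

Lemma prod_Dcells_hook (R : comPzRingType) : (0 < n)%N \/ a = 0%N ->
  \prod_(c <- Dcells n a) (shifted_hook la c)%:R =
  \prod_(k < a) \prod_(l < k.+1) ((y (n + k))%:R + (y l)%:R) :> R.
Proof.
move=> n_gt0; rewrite prod_Dcells; apply: eq_bigr => k _; apply: eq_bigr => l _.
have ka := ltn_ord k; have lk := ltn_ord l.
rewrite -natrD -(shifted_hook_pair yP); last by lia.
by congr (shifted_hook _ (_, _))%:R; lia.
Qed.

End DroppedHooks.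

Lemma lam_parts n a b m : (0 < m)%N ->
  lam n a b m = parts (n + a) (fun i => b.+1 + m * i)%N.
Proof.
case: m => // m _; apply/eq_in_map => k; rewrite mem_iota => kN.
by rewrite subn1 mulSn; lia.
Qed.

Lemma strict_pos_progression N b m : (0 < m)%N ->
  strict_pos N (fun i => b.+1 + m * i)%N.
Proof. by move=> m0; split=> i _; rewrite ?mulnS; lia. Qed.

Lemma stair_prodE (F : numFieldType) n a :
  (stair_prod n a)%:R = (Phi (n + 2 * a))%:R / (Phi (2 * a))%:R
    * ((gimel (2 * a))%:R * (gimel n)%:R / (gimel (n + 2 * a))%:R) :> F.
Proof.
have Phi0 k : (Phi k)%:R != 0 :> F by rewrite pnatr_eq0 -lt0n Phi_gt0.
have gimel0 k : (gimel k)%:R != 0 :> F by rewrite pnatr_eq0 -lt0n gimel_gt0.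
have /(congr1 (fun k => k%:R : F)) := Phi_gimel_stair_prod n a.
rewrite !natrM => PhiE; transitivity ((Phi (n + 2 * a))%:R * (gimel (2 * a))%:R
  * (gimel n)%:R / ((Phi (2 * a))%:R * (gimel (n + 2 * a))%:R) : F).
  by rewrite PhiE; field; rewrite Phi0 gimel0.
by field; rewrite Phi0 gimel0.
Qed.

Lemma num_SYT_progression n a b m : (0 < m)%N -> (0 < n)%N \/ a = 0%N ->
  let la := lam n a b m in
  let p := shifted_skew la (delta a.+1) in
  (num_SYT p)%:R = (#|` p|)`!%:R * (stair_prod n a * Phi a)%:R
    / (2 ^+ a * (Phi (n + a))%:R)
    / \prod_(c <- shifted_diagram la `\` Dcells n a) (shifted_hook la c)%:R :> rat.
Proof.
move=> m0 hna la p; pose y i := (b.+1 + m * i)%N.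
have yP := strict_pos_progression (n + a) b m0.
pose x := progression b.+1%:R m%:R : nat -> rat.
have xE i : (y i)%:R = x i by rewrite natrD natrM.
have dropE : \prod_(c <- Dcells n a) (shifted_hook (parts (n + a) y) c)%:R =
    \prod_(i < a) \prod_(j < i.+1) (x (n + i)%N + x j).
  by rewrite prod_Dcells_hook //; do 2![apply: eq_bigr => ? _]; rewrite !xE.
have := prod_shifted_hook_neq0 yP rat.
rewrite /p /la lam_parts // num_SYT_stair_hook // (prod_fsetD _ (Dcells_sub yP)) dropE.
rewrite mulf_eq0 negb_or => /andP[kept0 drop0].
rewrite (eq_altdet _ (fun i _ => xE i)) (eq_pairdiff (fun i _ => xE i)).
rewrite altdet_progression_ratio ?pnatr_eq0 -?lt0n // -/x.
by rewrite mulrA -mulf_div (divff drop0) mulr1 mulrA.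
Qed.

Theorem theorem4p1 (n a b m : nat) (hm : (1 <= m)%N)
    (hna : (1 <= n)%N \/ a = 0%N) :
  let la := lam n a b m in
  let p := shifted_skew la (delta a.+1) in
  (num_SYT p)%:R =
    ((#|` p|)`!)%:R / 2%:R ^+ a
    * ((Phi (n + 2 * a))%:R * (Phi a)%:R
       / ((Phi (2 * a))%:R * (Phi (n + a))%:R))
    * ((gimel (2 * a))%:R * (gimel n)%:R / (gimel (n + 2 * a))%:R)
    * \prod_(c <- shifted_diagram la `\` Dcells n a)
        (1 / (shifted_hook la c)%:R) :> rat.
Proof.
move=> la p; rewrite /p num_SYT_progression // natrM stair_prodE.
under [in RHS]eq_bigr do rewrite div1r.
by rewrite prodfV !invfM; ring.
Qed.
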